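(* Let $\mathcal{A}$ be a Hopf algebra with invertible antipode over a field $\Bbbk$ and let $P\in\mathcal{A}$ be a non-zero projection. The following conditions are equivalent: (1) $P$ is a right group-like projection such that $S(P)=P$; (2) $P$ is a right group-like projection such that $S^2(P)=P$; (3) $P$ is a right group-like projection such that $P\,S(P)=S(P)\,P$; (4) $P$ is a left group-like projection such that $S(P)=P$; (5) $P$ is a left group-like projection such that $S^2(P)=P$; (6) $P$ is a left group-like projection such that $P\,S(P)=S(P)\,P$; (7) $P$ is a two sided group-like projection; (8) $P$ satisfies $\Delta(P)(1\otimes P)=\Delta(P)(P\otimes 1)$.
   Context: $(\mathcal{A},\Delta,S,\varepsilon)$ denotes a Hopf algebra over an arbitrary field $\Bbbk$ with comultiplication $\Delta$, invertible antipode $S$ and counit $\varepsilon$; $1$ is its unit. A projection is an idempotent element ($P^2=P$). A non-zero projection $P\in\mathcal{A}$ is a right group-like projection if $\Delta(P)(1\otimes P)=P\otimes P=(1\otimes P)\Delta(P)$; a left group-like projection if $\Delta(P)(P\otimes 1)=P\otimes P=(P\otimes 1)\Delta(P)$; and a two sided group-like projection if it is both a left and a right group-like projection. *)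

(* Defs.v *)
From HB Require Import structures.
From mathcomp Require Import all_boot all_algebra.
From mathcomp Require Import boolp.

Set Implicit Arguments.
Unset Strict Implicit.
Unset Printing Implicit Defensive.

Import GRing.Theory.
Local Open Scope ring_scope.
Local Open Scope quotient_scope.

(* The tensor product of two (possibly infinite-dimensional) vector spaces:
   finite formal sums of pairs (u, v), two of them being identified when no
   bilinear map separates them.  The universal property is given by the lemmas
   tens_bilinear, tlift_linear, tlift_tens and tlift_unique below. *)
Section TensorProduct.
Variables (k : fieldType) (U V : lmodType k).
Implicit Types s t : seq (U * V).

Definition tens_eq s t : Prop :=
  forall (W : lmodType k) (f : U -> V -> W), bilinear_for *:%R *:%R f ->
    \sum_(p <- s) f p.1 p.2 = \sum_(p <- t) f p.1 p.2.

Definition tens_eqb s t : bool := `[< tens_eq s t >].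

Lemma tens_eqb_refl : reflexive tens_eqb.
Proof. by move=> s; apply/asboolP. Qed.

Lemma tens_eqb_sym : symmetric tens_eqb.
Proof.
by move=> s t; apply/asboolP/asboolP => st W f bf; rewrite (st W f bf).
Qed.

Lemma tens_eqb_trans : transitive tens_eqb.
Proof.
move=> t s r /asboolP st /asboolP tr; apply/asboolP => W f bf.
by rewrite (st W f bf) (tr W f bf).
Qed.

Canonical tens_equiv :=
  EquivRel tens_eqb tens_eqb_refl tens_eqb_sym tens_eqb_trans.

Definition tensor : Type := {eq_quot tens_equiv}.

HB.instance Definition _ := Choice.on tensor.
HB.instance Definition _ := EqQuotient.on tensor.

(* The linear map induced by f; only meaningful when f is bilinear. *)
Definition tlift (W : lmodType k) (f : U -> V -> W) (x : tensor) : W :=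
  \sum_(p <- repr x) f p.1 p.2.

Definition tens (u : U) (v : V) : tensor := \pi_tensor [:: (u, v)].

Lemma tlift_pi (W : lmodType k) (f : U -> V -> W) s :
    bilinear_for *:%R *:%R f ->
  tlift f (\pi_tensor s) = \sum_(p <- s) f p.1 p.2.
Proof.
move=> bf; have /eqmodP/asboolP : repr (\pi_tensor s) = s %[mod tensor].
  by rewrite reprK.
exact.
Qed.

Lemma tensorP (x y : tensor) :
    (forall (W : lmodType k) (f : U -> V -> W), bilinear_for *:%R *:%R f ->
       tlift f x = tlift f y) ->
  x = y.
Proof.
move=> xy; rewrite -[x]reprK -[y]reprK; apply/eqmodP/asboolP => W f bf.
exact: xy bf.
Qed.

Definition tzero : tensor := \pi_tensor [::].
Definition tadd (x y : tensor) : tensor := \pi_tensor (repr x ++ repr y).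
Definition tscale (c : k) (x : tensor) : tensor :=
  \pi_tensor [seq (c *: p.1, p.2) | p <- repr x].
Definition topp (x : tensor) : tensor := tscale (-1) x.

Section LiftOps.
Variables (W : lmodType k) (f : U -> V -> W).
Hypothesis bf : bilinear_for *:%R *:%R f.

Lemma bilinear_scalel c u v : f (c *: u) v = c *: f u v.
Proof.
have f0 : f 0 v = 0.
  by have /= := bf.1 v (-1) 0 0; rewrite scaler0 addr0 scaleN1r addNr.
by have /= := bf.1 v c u 0; rewrite addr0 f0 addr0.
Qed.

Lemma tlift_tzero : tlift f tzero = 0.
Proof. by rewrite tlift_pi // big_nil. Qed.

Lemma tlift_tadd x y : tlift f (tadd x y) = tlift f x + tlift f y.
Proof. by rewrite tlift_pi // big_cat. Qed.

Lemma tlift_tscale c x : tlift f (tscale c x) = c *: tlift f x.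
Proof.
rewrite tlift_pi // big_map scaler_sumr.
by apply: eq_bigr => p _; rewrite bilinear_scalel.
Qed.

Lemma tlift_topp x : tlift f (topp x) = - tlift f x.
Proof. by rewrite tlift_tscale scaleN1r. Qed.
End LiftOps.

Lemma taddA : associative tadd.
Proof. by move=> x y z; apply: tensorP => W f bf; rewrite !tlift_tadd// addrA. Qed.

Lemma taddC : commutative tadd.
Proof. by move=> x y; apply: tensorP => W f bf; rewrite !tlift_tadd// addrC. Qed.

Lemma tadd0 : left_id tzero tadd.
Proof.
by move=> x; apply: tensorP => W f bf; rewrite tlift_tadd// tlift_tzero// add0r.
Qed.

Lemma taddN : left_inverse tzero topp tadd.
Proof.
move=> x; apply: tensorP => W f bf.
by rewrite tlift_tadd// tlift_topp// tlift_tzero// addNr.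
Qed.

HB.instance Definition _ :=
  GRing.isZmodule.Build tensor taddA taddC tadd0 taddN.

Lemma tscaleA a b x : tscale a (tscale b x) = tscale (a * b) x.
Proof. by apply: tensorP => W f bf; rewrite !tlift_tscale// scalerA. Qed.

Lemma tscale1 : left_id 1 tscale.
Proof. by move=> x; apply: tensorP => W f bf; rewrite tlift_tscale// scale1r. Qed.

Lemma tscaleDr : right_distributive tscale +%R.
Proof.
move=> a x y; apply: tensorP => W f bf.
by rewrite !(tlift_tadd, tlift_tscale)// scalerDr.
Qed.

Lemma tscaleDl x : {morph tscale^~ x : a b / a + b}.
Proof.
move=> a b; apply: tensorP => W f bf.
by rewrite !(tlift_tadd, tlift_tscale)// scalerDl.
Qed.

HB.instance Definition _ := GRing.Zmodule_isLmodule.Build k tensor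
  tscaleA tscale1 tscaleDr tscaleDl.

Lemma tlift_linear (W : lmodType k) (f : U -> V -> W) :
  bilinear_for *:%R *:%R f -> linear (tlift f).
Proof. by move=> bf c x y; rewrite tlift_tadd// tlift_tscale. Qed.

Lemma tlift_tens (W : lmodType k) (f : U -> V -> W) u v :
  bilinear_for *:%R *:%R f -> tlift f (tens u v) = f u v.
Proof. by move=> bf; rewrite tlift_pi // big_seq1. Qed.

Lemma tens_bilinear : bilinear_for *:%R *:%R tens.
Proof.
split=> [v c u u'|u c v v']; apply: tensorP => W f bf.
- by rewrite tlift_linear// !tlift_tens// bf.1.
- by rewrite tlift_linear// !tlift_tens// bf.2.
Qed.

Lemma tensor_sum (x : tensor) : x = \sum_(p <- repr x) tens p.1 p.2.
Proof.
apply: tensorP => W f bf.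
have -> (s : seq (U * V)) : tlift f (\sum_(p <- s) tens p.1 p.2)
    = \sum_(p <- s) f p.1 p.2; last by [].
elim: s => [|p s IHs]; first by rewrite !big_nil tlift_tzero.
by rewrite !big_cons tlift_tadd// IHs tlift_tens.
Qed.

Lemma tensor_ind (Q : tensor -> Prop) :
    Q 0 -> (forall x y, Q x -> Q y -> Q (x + y)) ->
    (forall u v, Q (tens u v)) ->
  forall x, Q x.
Proof. by move=> Q0 QD Qt x; rewrite [x]tensor_sum; apply: big_ind. Qed.

Lemma tlift_unique (W : lmodType k) (f : U -> V -> W) (g : tensor -> W) :
    linear g -> bilinear_for *:%R *:%R f ->
  (forall u v, g (tens u v) = f u v) -> g =1 tlift f.
Proof.
move=> lg bf gf.
have g0 : g 0 = 0.
  by have /= := lg (-1) 0 0; rewrite scaler0 addr0 scaleN1r addNr.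
apply: tensor_ind; first by rewrite g0 tlift_tzero.
  move=> x y gx gy; have := lg 1 x y; rewrite !scale1r => ->.
  by rewrite tlift_tadd// gx gy.
by move=> u v; rewrite gf tlift_tens.
Qed.

End TensorProduct.

Notation "U ⊗ V" := (tensor U%type V%type) (at level 40, left associativity) : type_scope.
Notation "u ⊗ v" := (tens u v) (at level 40, left associativity) : ring_scope.

Section TensorAlgebra.
Variables (k : fieldType) (A B : algType k).

Definition tmul (x y : A ⊗ B) : A ⊗ B :=
  tlift (fun a b => tlift (fun c d => (a * c) ⊗ (b * d)) y) x.

Let inner_bilinear a b :
  bilinear_for *:%R *:%R (fun c d => (a * c) ⊗ (b * d) : A ⊗ B).
Proof.
split=> [d s c c'|c s d d'] /=.
- by rewrite mulrDr -scalerAr (tens_bilinear _ _).1.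
- by rewrite mulrDr -scalerAr (tens_bilinear _ _).2.
Qed.

Let outer_bilinear y : bilinear_for *:%R *:%R
  (fun a b => tlift (fun c d => (a * c) ⊗ (b * d)) y : A ⊗ B).
Proof.
split=> [b s a a'|a s b b'] /=; elim/tensor_ind: y => [|x y IHx IHy|c d].
1,4: by rewrite !tlift_tzero // scaler0 addr0.
1,3: by rewrite !tlift_tadd // IHx IHy scalerDr addrACA.
- by rewrite !tlift_tens // mulrDl -scalerAl (tens_bilinear _ _).1.
- by rewrite !tlift_tens // mulrDl -scalerAl (tens_bilinear _ _).2.
Qed.

Lemma tmul_tens a b c d :
  tmul (a ⊗ b) (c ⊗ d) = (a * c) ⊗ (b * d).
Proof. by rewrite /tmul !tlift_tens. Qed.

Lemma tmulZDl s x x' y : tmul (s *: x + x') y = s *: tmul x y + tmul x' y.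
Proof. by rewrite /tmul tlift_linear. Qed.

Lemma tmulZDr s x y y' : tmul x (s *: y + y') = s *: tmul x y + tmul x y'.
Proof.
elim/tensor_ind: x => [|x x' IHx IHx'|a b]; rewrite /tmul.
- by rewrite !tlift_tzero // scaler0 addr0.
- by rewrite !tlift_tadd // -!/(tmul _ _) IHx IHx' scalerDr addrACA.
- by rewrite !tlift_tens // tlift_linear.
Qed.

Lemma tmulDl : left_distributive tmul +%R.
Proof. by move=> x y z; have := tmulZDl 1 x y z; rewrite !scale1r. Qed.

Lemma tmulDr : right_distributive tmul +%R.
Proof. by move=> x y z; have := tmulZDr 1 x y z; rewrite !scale1r. Qed.

Lemma tmul0l y : tmul 0 y = 0.
Proof. by apply: (addrI (tmul 0 y)); rewrite -tmulDl !addr0. Qed.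

Lemma tmul0r x : tmul x 0 = 0.
Proof. by apply: (addrI (tmul x 0)); rewrite -tmulDr !addr0. Qed.

Lemma tmulA : associative tmul.
Proof.
move=> x y z; elim/tensor_ind: x => [|x x' IHx IHx'|a b].
- by rewrite !tmul0l.
- by rewrite !tmulDl IHx IHx'.
elim/tensor_ind: y => [|y y' IHy IHy'|c d].
- by rewrite !(tmul0l, tmul0r).
- by rewrite !(tmulDl, tmulDr) IHy IHy'.
elim/tensor_ind: z => [|z z' IHz IHz'|e f].
- by rewrite !tmul0r.
- by rewrite !tmulDr IHz IHz'.
by rewrite !tmul_tens !mulrA.
Qed.

Lemma tmul1l : left_id (1 ⊗ 1) tmul.
Proof.
elim/tensor_ind => [|x y IHx IHy|a b]; first exact: tmul0r.
  by rewrite tmulDr IHx IHy.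
by rewrite tmul_tens !mul1r.
Qed.

Lemma tmul1r : right_id (1 ⊗ 1) tmul.
Proof.
elim/tensor_ind => [|x y IHx IHy|a b]; first exact: tmul0l.
  by rewrite tmulDl IHx IHy.
by rewrite tmul_tens !mulr1.
Qed.

(* The library's algebra structures require 1 != 0, whose proof for the tensor
   product would need linear functionals; only the ring axioms are used. *)
HB.instance Definition _ := GRing.Zmodule_isPzRing.Build (tensor A B)
  tmulA tmul1l tmul1r tmulDl tmulDr.

Lemma tensM (a c : A) (b d : B) : (a ⊗ b) * (c ⊗ d) = (a * c) ⊗ (b * d).
Proof. exact: tmul_tens. Qed.

Lemma tens1 : 1 ⊗ 1 = 1 :> A ⊗ B.
Proof. by []. Qed.

Lemma tens_scalerAl (s : k) (x y : A ⊗ B) : s *: (x * y) = (s *: x) * y.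
Proof. by have := tmulZDl s x 0 y; rewrite tmul0l !addr0 => /esym. Qed.

Lemma tens_scalerAr (s : k) (x y : A ⊗ B) : s *: (x * y) = x * (s *: y).
Proof. by have := tmulZDr s x y 0; rewrite tmul0r !addr0 => /esym. Qed.

End TensorAlgebra.

Section TensorMaps.
Variable k : fieldType.

Definition tmap (U U' V V' : lmodType k) (f : U -> U') (g : V -> V') :
    U ⊗ V -> U' ⊗ V' :=
  tlift (fun u v => f u ⊗ g v).

Definition tassoc (U V W : lmodType k) : (U ⊗ V) ⊗ W -> U ⊗ (V ⊗ W) :=
  tlift (fun x w => tlift (fun u v => u ⊗ (v ⊗ w)) x).

Lemma tmap_bilinear (U U' V V' : lmodType k)
    (f : {linear U -> U'}) (g : {linear V -> V'}) :
  bilinear_for *:%R *:%R (fun u v => f u ⊗ g v).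
Proof.
split=> [v c u u'|u c v v'] /=.
- by rewrite linearP (tens_bilinear _ _).1.
- by rewrite linearP (tens_bilinear _ _).2.
Qed.

Lemma tmap_tens (U U' V V' : lmodType k)
    (f : {linear U -> U'}) (g : {linear V -> V'}) u v :
  tmap f g (u ⊗ v) = f u ⊗ g v.
Proof. by rewrite /tmap tlift_tens //; exact: tmap_bilinear. Qed.

Lemma tassoc_inner_bilinear (U V W : lmodType k) (w : W) :
  bilinear_for *:%R *:%R (fun (u : U) (v : V) => u ⊗ (v ⊗ w)).
Proof.
split=> [v c u u'|u c v v'] /=; first by rewrite (tens_bilinear _ _).1.
by rewrite (tens_bilinear _ _).1 (tens_bilinear _ _).2.
Qed.

Lemma tassoc_bilinear (U V W : lmodType k) : bilinear_for *:%R *:%R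
  (fun (x : U ⊗ V) (w : W) => tlift (fun u v => u ⊗ (v ⊗ w)) x).
Proof.
split=> [w c x x'|x c w w'] /=.
  by rewrite tlift_linear //; exact: tassoc_inner_bilinear.
have bl := @tassoc_inner_bilinear U V W.
elim/tensor_ind: x => [|x y IHx IHy|u v].
- by rewrite !tlift_tzero // scaler0 addr0.
- by rewrite !tlift_tadd // IHx IHy scalerDr addrACA.
- by rewrite !tlift_tens // !(tens_bilinear _ _).2.
Qed.

Lemma tassoc_tens (U V W : lmodType k) (u : U) (v : V) (w : W) :
  tassoc ((u ⊗ v) ⊗ w) = u ⊗ (v ⊗ w).
Proof.
rewrite /tassoc tlift_tens; last exact: tassoc_bilinear.
by rewrite tlift_tens //; exact: tassoc_inner_bilinear.
Qed.

End TensorMaps.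

Record hopfAlgebra (k : fieldType) (A : algType k) := HopfAlgebra {
  comul : {linear A -> (A ⊗ A)%type};
  counit : {scalar A};
  antipode : {linear A -> A};
  comulA : forall a,
    tassoc (tmap comul idfun (comul a)) = tmap idfun comul (comul a);
  comul_counitl : forall a, tlift (fun x y => counit x *: y) (comul a) = a;
  comul_counitr : forall a, tlift (fun x y => counit y *: x) (comul a) = a;
  comul_monoid_morphism : monoid_morphism comul;
  counit_monoid_morphism : monoid_morphism counit;
  antipodel : forall a,
    tlift (fun x y => antipode x * y) (comul a) = counit a *: 1;
  antipoder : forall a,
    tlift (fun x y => x * antipode y) (comul a) = counit a *: 1
}.

Lemma counitl_bilinear (k : fieldType) (A : algType k) (e : {scalar A}) :
  bilinear_for *:%R *:%R (fun x y : A => e x *: y).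
Proof.
split=> [y c x x'|x c y y'] /=.
- by rewrite linearP scalerDl scalerA.
- by rewrite scalerDr !scalerA mulrC.
Qed.

Lemma counitr_bilinear (k : fieldType) (A : algType k) (e : {scalar A}) :
  bilinear_for *:%R *:%R (fun x y : A => e y *: x).
Proof.
split=> [y c x x'|x c y y'] /=.
- by rewrite scalerDr !scalerA mulrC.
- by rewrite linearP scalerDl scalerA.
Qed.

Lemma antipodel_bilinear (k : fieldType) (A : algType k)
    (S : {linear A -> A}) :
  bilinear_for *:%R *:%R (fun x y : A => S x * y).
Proof.
split=> [y c x x'|x c y y'] /=.
- by rewrite linearP mulrDl scalerAl.
- by rewrite mulrDr scalerAr.
Qed.

Lemma antipoder_bilinear (k : fieldType) (A : algType k)
    (S : {linear A -> A}) :
  bilinear_for *:%R *:%R (fun x y : A => x * S y).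
Proof.
split=> [y c x x'|x c y y'] /=.
- by rewrite mulrDl scalerAl.
- by rewrite linearP mulrDr scalerAr.
Qed.

Section GroupLikeProjections.
Variables (k : fieldType) (A : algType k) (H : hopfAlgebra A).

Definition is_projection (P : A) : Prop := P * P = P.

Definition right_group_like (P : A) : Prop :=
  [/\ is_projection P, P <> 0,
      comul H P * (1 ⊗ P) = P ⊗ P & P ⊗ P = (1 ⊗ P) * comul H P].

Definition left_group_like (P : A) : Prop :=
  [/\ is_projection P, P <> 0,
      comul H P * (P ⊗ 1) = P ⊗ P & P ⊗ P = (P ⊗ 1) * comul H P].

Definition two_sided_group_like (P : A) : Prop :=
  left_group_like P /\ right_group_like P.

End GroupLikeProjections.

(* Main.v *)
Require Import Defs.
From mathcomp Require Import all_boot all_algebra.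
Import GRing.Theory.
Local Open Scope ring_scope.

(** Every condition forces S(P) = P.  If P is right group-like, evaluating
    S(x)y on Delta(P)(1 ⊗ P) = P ⊗ P and x S(y) on (1 ⊗ P)Delta(P) = P ⊗ P
    collapses the left-hand sides by the antipode axioms and gives
      S(P) P = P   and   P S(P) = S(P);
    a left group-like P satisfies S(P) P = S(P) and P S(P) = P in the same way.
    So S(P) = P as soon as P commutes with S(P), as soon as both pairs hold, or
    as soon as S^2(P) = P (apply the antimultiplicative S to one of the
    identities).

    When S(P) = P the antiautomorphism x ⊗ y |-> S(y) ⊗ S(x) of A ⊗ A fixes
    Delta(P) and P ⊗ P, because S reverses the coproduct, and it exchanges
    1 ⊗ P with P ⊗ 1.  It therefore exchanges the right and the left
    conditions, which makes (1)-(7) equivalent; (7) gives (8) at once.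

    For the converse, let (8) say P1 ⊗ P2 P = P1 P ⊗ P2.  The counit gives
    eps(P) = 1 and the antipode gives S(P) = P.  Expanding the first leg and
    contracting the last two by S(v)y turns (8) into P P1 ⊗ S(P2) = P ⊗ P
    ([mul_comul_antipode_tens]); applying S to the first leg and flipping, the
    left-hand side becomes Delta(S(P))(1 ⊗ S(P)) = Delta(P)(1 ⊗ P), the right-hand
    side P ⊗ P.  By (8) this is also Delta(P)(P ⊗ 1), and the antiautomorphism
    turns that into (1 ⊗ P)Delta(P) = P ⊗ P, so P is right group-like.

    Antimultiplicativity of S ([antipodeM]) and reversal of the coproduct
    ([comul_antipode]) are both obtained by computing, in two ways, the
    convolution product of two candidates for the inverse with the map that
    they should invert. *)

(** * Linearity of expressions *)

Section Linearity.
Set Implicit Arguments.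
Unset Strict Implicit.
Variable k : fieldType.
Implicit Types U V W : lmodType k.

Lemma linear_idfun U : linear (fun x : U => x).
Proof. by []. Qed.

Lemma linear_comp U V W (g : V -> W) (f : U -> V) :
  linear g -> linear f -> linear (fun x => g (f x)).
Proof. by move=> lg lf c x y; rewrite /= lf lg. Qed.

Lemma linear_app U V W (g : {linear V -> W}) (f : U -> V) :
  linear f -> linear (fun x => g (f x)).
Proof. by apply: linear_comp; apply: linearP. Qed.

Lemma linear_mull (A : algType k) U (f : U -> A) (b : A) :
  linear f -> linear (fun x => f x * b).
Proof. by move=> lf c x y; rewrite /= lf mulrDl scalerAl. Qed.

Lemma linear_mulr (A : algType k) U (f : U -> A) (b : A) :
  linear f -> linear (fun x => b * f x).
Proof. by move=> lf c x y; rewrite /= lf mulrDr scalerAr. Qed.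

Lemma linear_tens_mull (A : algType k) U (f : U -> (A ⊗ A)%type) b :
  linear f -> linear (fun x => f x * b).
Proof. by move=> lf c x y; rewrite /= lf mulrDl tens_scalerAl. Qed.

Lemma linear_tens_mulr (A : algType k) U (f : U -> (A ⊗ A)%type) b :
  linear f -> linear (fun x => b * f x).
Proof. by move=> lf c x y; rewrite /= lf mulrDr tens_scalerAr. Qed.

Lemma linear_tensl U V W (f : U -> V) (w : W) :
  linear f -> linear (fun x => f x ⊗ w).
Proof. by move=> lf c x y; rewrite /= lf (tens_bilinear _ _).1. Qed.

Lemma linear_tensr U V W (f : U -> V) (w : W) :
  linear f -> linear (fun x => w ⊗ f x).
Proof. by move=> lf c x y; rewrite /= lf (tens_bilinear _ _).2. Qed.

Lemma linear_scale U V (e : {scalar U}) (v : V) :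
  linear (fun x => e x *: v).
Proof. by move=> c x y; rewrite /= linearP scalerDl scalerA. Qed.

Lemma linear_scaler U V (f : U -> V) (c : k) :
  linear f -> linear (fun x => c *: f x).
Proof. by move=> lf b x y; rewrite /= lf scalerDr !scalerA mulrC. Qed.

Lemma linear_for0 U V (f : U -> V) : linear f -> f 0 = 0.
Proof.
by move=> lf; have /= := lf (-1) 0 0; rewrite scaler0 addr0 scaleN1r addNr.
Qed.

Lemma linear_for_sum U V (f : U -> V) (I : Type) (r : seq I) (F : I -> U) :
  linear f -> f (\sum_(i <- r) F i) = \sum_(i <- r) f (F i).
Proof.
move=> lf; apply: (big_morph f) => [x y|]; last exact: linear_for0.
by have /= := lf 1 x y; rewrite !scale1r.
Qed.

Lemma linear_forZ U V (f : U -> V) c x : linear f -> f (c *: x) = c *: f x.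
Proof.
by move=> lf; have /= := lf c x 0; rewrite !addr0 (linear_for0 lf) addr0.
Qed.

End Linearity.

(** * Sums over the coproduct *)

Section Sweedler.
Set Implicit Arguments.
Unset Strict Implicit.
Context {k : fieldType} {A : algType k} (H : hopfAlgebra A).
Implicit Types (a b : A) (W : lmodType k).

Definition sweedler W a (f : A -> A -> W) : W := tlift f (comul H a).
Arguments sweedler {W} a f.

Local Notation "'\sw_' ( x , y <- a ) E" := (sweedler a (fun x y => E))
  (at level 41, E at level 41, x name, y name, a at level 41,
   format "'\sw_' ( x ,  y  <-  a )  E").
Local Notation S := (antipode H).
Local Notation eps := (counit H).
Local Notation Delta := (comul H).

Lemma eq_sweedler W a (f g : A -> A -> W) :
  (forall x y, f x y = g x y) -> sweedler a f = sweedler a g.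
Proof. by move=> fg; apply: eq_bigr. Qed.

Lemma linear_tensE W (G : (A ⊗ A)%type -> W) a :
  linear G -> G (Delta a) = \sw_(x, y <- a) G (x ⊗ y).
Proof.
by move=> lG; rewrite {1}[Delta a]tensor_sum linear_for_sum.
Qed.

Lemma comul_sweedler a : Delta a = \sw_(x, y <- a) (x ⊗ y).
Proof. exact: (linear_tensE (G := fun x => x)). Qed.

Lemma linear_sweedler W a (f : A -> A -> W) (V : lmodType k) (g : W -> V) :
  linear g -> g (sweedler a f) = \sw_(x, y <- a) g (f x y).
Proof. exact: linear_for_sum. Qed.

Lemma linear_sweedler_body (U : lmodType k) W a (f : U -> A -> A -> W) :
  (forall x y, linear (fun u => f u x y)) ->
  linear (fun u => sweedler a (f u)).
Proof.
move=> lf c u v; rewrite /sweedler /tlift scaler_sumr -big_split /=.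
by apply: eq_bigr => p _; apply: lf.
Qed.

Lemma linear_sweedler_arg (U : lmodType k) W (g : U -> A) (f : A -> A -> W) :
    (forall y, linear (fun x => f x y)) -> (forall x, linear (fun y => f x y)) ->
    linear g ->
  linear (fun u => sweedler (g u) f).
Proof.
move=> l1 l2 lg c u v; rewrite /sweedler lg linearP.
exact: (@tlift_linear k A A W f (l1, l2)).
Qed.

(* In a multilinear expression each variable occurs once, so it suffices to
   follow the variable of interest down to its occurrence. *)
Ltac multilinear :=
  repeat match goal with |- forall _ : _, _ => intro end; cbv beta;
  first
  [ apply: linear_idfun
  | assumption
  | apply: linear_sweedler_body; multilinear
  | apply: linear_sweedler_arg; multilinear
  | apply: linear_tensl; multilinear
  | apply: linear_tensr; multilinear
  | apply: linear_mull; multilinear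
  | apply: linear_mulr; multilinear
  | apply: linear_tens_mull; multilinear
  | apply: linear_tens_mulr; multilinear
  | apply: linear_scale
  | apply: linear_scaler; multilinear
  | apply: linear_app; multilinear ].
Ltac bilinear := by split; multilinear.

(** Coassociativity compares elements of (A ⊗ A) ⊗ A and A ⊗ (A ⊗ A); a map f
    that is linear in each variable factors through the latter. *)
Lemma sweedler_coassoc W a (f : A -> A -> A -> W) :
    (forall y z, linear (fun x => f x y z)) ->
    (forall x z, linear (fun y => f x y z)) ->
    (forall x y, linear (fun z => f x y z)) ->
  \sw_(x, z <- a) (\sw_(u, v <- x) f u v z) =
  \sw_(x, y <- a) (\sw_(u, v <- y) f x u v).
Proof.
move=> l1 l2 l3.
have bf x : bilinear_for *:%R *:%R (f x) by split.
have bL : bilinear_for *:%R *:%R (fun x (t : (A ⊗ A)%type) => tlift (f x) t).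
  split=> [t c x x'|x] /=; last exact: tlift_linear.
  rewrite /tlift scaler_sumr -big_split /=.
  by apply: eq_bigr => p _; apply: l1.
pose L := tlift (fun x t => tlift (f x) t) : (A ⊗ (A ⊗ A))%type -> W.
have lL : linear L by apply: tlift_linear.
have lassoc : linear (@tassoc k A A A).
  by apply: tlift_linear; apply: tassoc_bilinear.
have lmap1 : linear (tmap Delta (idfun : A -> A)).
  by apply: tlift_linear; apply: (tmap_bilinear Delta (idfun : {linear A -> A})).
have lmap2 : linear (tmap (idfun : A -> A) Delta).
  by apply: tlift_linear; apply: (tmap_bilinear (idfun : {linear A -> A}) Delta).
have := congr1 L (comulA H a).
rewrite (linear_tensE (G := fun t => L (tassoc (tmap Delta idfun t)))); last first.
  by apply: (linear_comp lL) => //; apply: linear_comp.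
rewrite (linear_tensE (G := fun t => L (tmap idfun Delta t))); last first.
  exact: linear_comp.
have -> : \sw_(x, y <- a) L (tassoc (tmap Delta idfun (x ⊗ y))) =
          \sw_(x, y <- a) (\sw_(u, v <- x) f u v y).
  apply: eq_sweedler => x y; rewrite (tmap_tens Delta (idfun : {linear A -> A})).
  rewrite (linear_tensE (G := fun t => L (tassoc (t ⊗ _)))); last first.
    apply: (linear_comp lL) => //; apply: linear_comp => //.
    by apply: linear_tensl.
  by apply: eq_sweedler => u v; rewrite tassoc_tens /L !tlift_tens.
move->; apply: eq_sweedler => x y.
by rewrite (tmap_tens (idfun : {linear A -> A}) Delta) /L tlift_tens.
Qed.

Lemma sweedler_exchange W a b (f : A -> A -> A -> A -> W) :
  \sw_(x, y <- a) (\sw_(u, v <- b) f x y u v) =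
  \sw_(u, v <- b) (\sw_(x, y <- a) f x y u v).
Proof. exact: exchange_big. Qed.

Lemma tlift_comul_mulr W a c d (f : A -> A -> W) :
    bilinear_for *:%R *:%R f ->
  tlift f (Delta a * (c ⊗ d)) = \sw_(x, y <- a) f (x * c) (y * d).
Proof.
move=> bf; rewrite (linear_tensE (G := fun t => tlift f (t * _))).
  by apply: eq_sweedler => x y; rewrite tensM tlift_tens.
by apply: (linear_comp (tlift_linear bf)); multilinear.
Qed.

Lemma tlift_comul_mull W a c d (f : A -> A -> W) :
    bilinear_for *:%R *:%R f ->
  tlift f ((c ⊗ d) * Delta a) = \sw_(x, y <- a) f (c * x) (d * y).
Proof.
move=> bf; rewrite (linear_tensE (G := fun t => tlift f (_ * t))).
  by apply: eq_sweedler => x y; rewrite tensM tlift_tens.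
by apply: (linear_comp (tlift_linear bf)); multilinear.
Qed.

Lemma sweedlerM W a b (f : A -> A -> W) :
    bilinear_for *:%R *:%R f ->
  sweedler (a * b) f =
  \sw_(x, y <- a) (\sw_(u, v <- b) f (x * u) (y * v)).
Proof.
move=> bf; rewrite /sweedler (comul_monoid_morphism H).2.
rewrite (linear_tensE (G := fun t => tlift f (t * _))).
  by apply: eq_sweedler => x y; rewrite tlift_comul_mull.
by apply: (linear_comp (tlift_linear bf)); multilinear.
Qed.

Lemma sweedler_counitl W a (g : A -> W) :
  linear g -> \sw_(x, y <- a) (eps x *: g y) = g a.
Proof.
move=> lg; rewrite -[in RHS](comul_counitl H a).
rewrite -/(sweedler a _) (linear_sweedler _ _ lg).
by apply: eq_sweedler => x y; rewrite linear_forZ.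
Qed.

Lemma sweedler_counitr W a (g : A -> W) :
  linear g -> \sw_(x, y <- a) (eps y *: g x) = g a.
Proof.
move=> lg; rewrite -[in RHS](comul_counitr H a).
rewrite -/(sweedler a _) (linear_sweedler _ _ lg).
by apply: eq_sweedler => x y; rewrite linear_forZ.
Qed.

Lemma sweedler_antipodel W a (g : A -> W) :
  linear g -> \sw_(x, y <- a) g (S x * y) = eps a *: g 1.
Proof.
by move=> lg; rewrite -linear_forZ // -(antipodel H a) -/(sweedler a _) linear_sweedler.
Qed.

Lemma sweedler_antipoder W a (g : A -> W) :
  linear g -> \sw_(x, y <- a) g (x * S y) = eps a *: g 1.
Proof.
by move=> lg; rewrite -linear_forZ // -(antipoder H a) -/(sweedler a _) linear_sweedler.
Qed.

(** * The antipode reverses products and coproducts *)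

Lemma antipode1 : S 1 = 1.
Proof.
have := antipodel H 1.
rewrite (counit_monoid_morphism H).1 scale1r (comul_monoid_morphism H).1.
rewrite -tens1 tlift_tens ?mulr1 //; exact: antipodel_bilinear.
Qed.

(** The maps S(b)S(a) and S(ab) of a ⊗ b are a left and a right convolution
    inverse of the product, so they both equal
    S(b1) S(a1) (a2 b2) S(a3 b3). *)
Lemma antipodeM a b : S (a * b) = S b * S a.
Proof.
(* S(b1) S(a1) a2 b2 collapses from the inside out. *)
have contract x u t :
    \sw_(c, d <- x) (\sw_(e, f <- u) ((S e * S c) * ((d * f) * t))) =
    eps x *: (eps u *: t).
  rewrite sweedler_exchange.
  under eq_sweedler => e f.
    rewrite (eq_sweedler _ (g := fun c d => S e * (S c * d) * (f * t)));
      last by move=> c d; rewrite !mulrA.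
    rewrite (sweedler_antipodel _ (g := fun t' => S e * t' * (f * t)));
      last by multilinear.
    rewrite mulr1 mulrA.
    over.
  rewrite -(linear_sweedler _ _ (g := fun t' => eps x *: t'));
    last by multilinear.
  rewrite (sweedler_antipodel _ (g := fun t' => t' * t)) ?mul1r //.
  by multilinear.
transitivity (\sw_(x, y <- a) (\sw_(u, v <- b)
                (eps x *: (eps u *: S (y * v))))).
  under eq_sweedler => x y.
    rewrite -(linear_sweedler _ _ (g := fun t => eps x *: t));
      last by multilinear.
    rewrite sweedler_counitl; last by multilinear.
    over.
  by rewrite sweedler_counitl //; multilinear.
under eq_sweedler => x y.
  under eq_sweedler => u v do rewrite -contract.
  rewrite sweedler_exchange.
  over.
rewrite sweedler_coassoc; [|by multilinear..].
transitivity (\sw_(x, y <- a) (\sw_(u, v <- b)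
                (eps v *: (eps y *: (S u * S x))))).
  apply: eq_sweedler => x y.
  transitivity (\sw_(c, d <- y) (\sw_(u, v <- b) (\sw_(e, f <- v)
                  (S u * S x * (c * e * S (d * f)))))).
    apply: eq_sweedler => c d.
    by rewrite sweedler_coassoc; [|by multilinear..].
  rewrite sweedler_exchange; apply: eq_sweedler => u v.
  rewrite -(sweedlerM _ _ (f := fun c d => S u * S x * (c * S d))); last by bilinear.
  rewrite (sweedler_antipoder _ (g := fun t => S u * S x * t));
    last by multilinear.
  by rewrite (counit_monoid_morphism H).2 mulr1 mulrC scalerA.
under eq_sweedler => x y.
  rewrite sweedler_counitr; last by multilinear.
  over.
by rewrite sweedler_counitr //; multilinear.
Qed.

(** Delta S and S(a2) ⊗ S(a1) are a left and a right convolution inverse of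
    Delta in the linear maps from A to A ⊗ A, so they both equal
    Delta(S(a1)) Delta(a2) (S(a4) ⊗ S(a3)). *)
Lemma comul_antipode a : Delta (S a) = \sw_(x, y <- a) (S y ⊗ S x).
Proof.
pose T w : (A ⊗ A)%type := \sw_(u, v <- w) (S v ⊗ S u).
have lT : linear T by rewrite /T; multilinear.
(* The four factors w1 S(w4) ⊗ w2 S(w3) also collapse from the inside out. *)
have contract w : \sw_(z, t <- w) (Delta z * T t) = eps w *: (1 ⊗ 1).
  transitivity (\sw_(z, t <- w) (\sw_(p, q <- z) (\sw_(u, v <- t)
                  ((p * S v) ⊗ (q * S u))))).
    apply: eq_sweedler => z t; rewrite comul_sweedler.
    rewrite (linear_sweedler _ _ (g := fun r : (A ⊗ A)%type => r * T t)); last by multilinear.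
    apply: eq_sweedler => p q; rewrite /T.
    rewrite (linear_sweedler _ _ (g := fun r : (A ⊗ A)%type => p ⊗ q * r));
      last by multilinear.
    by apply: eq_sweedler => u v; rewrite tensM.
  rewrite sweedler_coassoc; [|by multilinear..].
  under eq_sweedler => p r.
    rewrite -sweedler_coassoc; [|by multilinear..].
    under eq_sweedler => s v.
      rewrite (sweedler_antipoder _ (g := fun h => (p * S v) ⊗ h));
        last by multilinear.
      over.
    rewrite sweedler_counitl; last by multilinear.
    over.
  by rewrite (sweedler_antipoder _ (g := fun h => h ⊗ 1)) //; multilinear.
transitivity (\sw_(x, y <- a) (\sw_(z, t <- y) (Delta (S x) * (Delta z * T t)))).
  under [RHS]eq_sweedler => x y.
    rewrite -(linear_sweedler _ _ (g := fun r : (A ⊗ A)%type => Delta (S x) * r));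
      last by multilinear.
    rewrite contract -tens_scalerAr tens1 mulr1.
    over.
  by rewrite sweedler_counitr //; multilinear.
rewrite -sweedler_coassoc; [|by multilinear..|]; last first.
  by move=> x y; apply: linear_tens_mulr; apply: linear_tens_mulr.
transitivity (\sw_(x, y <- a) (eps x *: T y)); last exact: sweedler_counitl.
apply: eq_sweedler => x t.
under eq_sweedler => y z do rewrite mulrA -(comul_monoid_morphism H).2.
rewrite (sweedler_antipodel _ (g := fun r => Delta r * T t)).
  by rewrite (comul_monoid_morphism H).1 mul1r.
by multilinear.
Qed.

Definition tens_antipode_flip (t : (A ⊗ A)%type) : (A ⊗ A)%type :=
  tlift (fun x y => S y ⊗ S x) t.

Lemma antipode_flip_bilinear :
  bilinear_for *:%R *:%R (fun x y : A => S y ⊗ S x).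
Proof. by bilinear. Qed.

Lemma tens_antipode_flip_tens a b : tens_antipode_flip (a ⊗ b) = S b ⊗ S a.
Proof. by rewrite /tens_antipode_flip tlift_tens //; apply: antipode_flip_bilinear. Qed.

Lemma tens_antipode_flip_comul a : tens_antipode_flip (Delta a) = Delta (S a).
Proof. by rewrite comul_antipode. Qed.

Lemma tens_antipode_flipM t t' :
  tens_antipode_flip (t * t') = tens_antipode_flip t' * tens_antipode_flip t.
Proof.
have bf := antipode_flip_bilinear.
have flip0 : tens_antipode_flip 0 = 0 by apply: tlift_tzero.
have flipD x y : tens_antipode_flip (x + y) =
                 tens_antipode_flip x + tens_antipode_flip y.
  exact: tlift_tadd.
elim/tensor_ind: t => [|x y IHx IHy|a b]; first by rewrite mul0r flip0 mulr0.
  by rewrite mulrDl !flipD mulrDr IHx IHy.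
elim/tensor_ind: t' => [|x y IHx IHy|c d]; first by rewrite mulr0 flip0 mul0r.
  by rewrite mulrDr !flipD mulrDl IHx IHy.
by rewrite tensM !tens_antipode_flip_tens tensM !antipodeM.
Qed.

(** * Group-like projections *)

Lemma counit_eq1 P : P <> 0 -> eps P *: P = P -> eps P = 1.
Proof.
move=> /eqP P0 eP; apply/eqP; rewrite -subr_eq0.
have : (eps P - 1) *: P == 0 by rewrite scalerBl scale1r eP subrr.
by rewrite scaler_eq0 (negPf P0) orbF.
Qed.

(** Applying x ⊗ y |-> S(x) y and x ⊗ y |-> x S(y), the factor coming from the
    second leg, P in the first case and S(P) in the second because S is
    antimultiplicative, ends up outside the sum that the antipode axiom
    contracts. *)
Lemma right_group_like_antipode P :
  right_group_like H P -> S P * P = P /\ P * S P = S P.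
Proof.
case=> PP P0 rP lP.
have eP : eps P = 1.
  apply: counit_eq1 => //.
  have bf := counitl_bilinear eps.
  have := congr1 (tlift (fun x y => eps x *: y)) rP.
  rewrite tlift_comul_mulr // tlift_tens //.
  under eq_sweedler => x y do rewrite mulr1.
  by rewrite (sweedler_counitl _ (g := fun y => y * P)) ?PP //; multilinear.
split.
  have bf := antipodel_bilinear S.
  have := congr1 (tlift (fun x y => S x * y)) rP.
  rewrite tlift_comul_mulr // tlift_tens //.
  under eq_sweedler => x y do rewrite mulr1 mulrA.
  rewrite (sweedler_antipodel _ (g := fun t => t * P)); last by multilinear.
  by rewrite eP scale1r mul1r.
have bf := antipoder_bilinear S.
have := congr1 (tlift (fun x y => x * S y)) lP.
rewrite tlift_comul_mull // tlift_tens //.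
under eq_sweedler => x y do rewrite mul1r antipodeM mulrA.
rewrite (sweedler_antipoder _ (g := fun t => t * S P)); last by multilinear.
by rewrite eP scale1r mul1r.
Qed.

(** The extra factor now sits on the first leg and comes out on the left, as S(P)
    for S(x) y and as P for x S(y). *)
Lemma left_group_like_antipode P :
  left_group_like H P -> S P * P = S P /\ P * S P = P.
Proof.
case=> PP P0 rP lP.
have eP : eps P = 1.
  apply: counit_eq1 => //.
  have bf := counitr_bilinear eps.
  have := congr1 (tlift (fun x y => eps y *: x)) rP.
  rewrite tlift_comul_mulr // tlift_tens //.
  under eq_sweedler => x y do rewrite mulr1.
  by rewrite (sweedler_counitr _ (g := fun y => y * P)) ?PP //; multilinear.
split.
  have bf := antipodel_bilinear S.
  have := congr1 (tlift (fun x y => S x * y)) rP.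
  rewrite tlift_comul_mulr // tlift_tens //.
  under eq_sweedler => x y do rewrite mulr1 antipodeM -mulrA.
  rewrite (sweedler_antipodel _ (g := fun t => S P * t)); last by multilinear.
  by rewrite eP scale1r mulr1.
have bf := antipoder_bilinear S.
have := congr1 (tlift (fun x y => x * S y)) lP.
rewrite tlift_comul_mull // tlift_tens //.
under eq_sweedler => x y do rewrite mul1r -mulrA.
rewrite (sweedler_antipoder _ (g := fun t => P * t)); last by multilinear.
by rewrite eP scale1r mulr1.
Qed.

(** The antipode flip fixes Delta(P) and P ⊗ P and exchanges 1 ⊗ P with P ⊗ 1. *)
Lemma right_group_like_left P :
  S P = P -> right_group_like H P -> left_group_like H P.
Proof.
move=> SP [PP P0 /(congr1 tens_antipode_flip) rP /(congr1 tens_antipode_flip) lP].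
move: rP lP.
rewrite !tens_antipode_flipM tens_antipode_flip_comul !tens_antipode_flip_tens.
by rewrite antipode1 SP.
Qed.

Lemma left_group_like_right P :
  S P = P -> left_group_like H P -> right_group_like H P.
Proof.
move=> SP [PP P0 /(congr1 tens_antipode_flip) rP /(congr1 tens_antipode_flip) lP].
move: rP lP.
rewrite !tens_antipode_flipM tens_antipode_flip_comul !tens_antipode_flip_tens.
by rewrite antipode1 SP.
Qed.

(** Applying Delta to the first leg gives
    P1 ⊗ P2 ⊗ P3 P = P1 P1' ⊗ P2 P2' ⊗ P3; under u ⊗ v ⊗ y |-> u ⊗ S(v) y the
    left-hand side contracts to P ⊗ P, and S(P2 P2') P3 = S(P2') S(P2) P3
    contracts on the right-hand side. *)
Lemma mul_comul_antipode_tens P :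
    Delta P * (1 ⊗ P) = Delta P * (P ⊗ 1) ->
  \sw_(x, y <- P) ((P * x) ⊗ S y) = P ⊗ P.
Proof.
move=> eqP.
have bf : bilinear_for *:%R *:%R
    (fun x y : A => \sw_(u, v <- x) (u ⊗ (S v * y))) by bilinear.
have := congr1 (tlift (fun x y => \sw_(u, v <- x) (u ⊗ (S v * y)))) eqP.
rewrite !tlift_comul_mulr //.
have -> : \sw_(x, y <- P) (\sw_(u, v <- x * 1) (u ⊗ (S v * (y * P)))) = P ⊗ P.
  under eq_sweedler => x y do rewrite mulr1.
  rewrite (sweedler_coassoc _ (f := fun u v y => u ⊗ (S v * (y * P))));
    [|by multilinear..].
  under eq_sweedler => x y.
    under eq_sweedler => u v do rewrite mulrA.
    rewrite (sweedler_antipodel _ (g := fun t => x ⊗ (t * P)));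
      last by multilinear.
    rewrite mul1r.
    over.
  by rewrite (sweedler_counitr _ (g := fun x => x ⊗ P)) //; multilinear.
move=> ->.
transitivity (\sw_(x, y <- P) (\sw_(u, v <- x) (\sw_(u', v' <- P)
                ((u * u') ⊗ (S v' * (S v * y)))))); last first.
  apply: eq_sweedler => x y; rewrite sweedlerM; last by bilinear.
  apply: eq_sweedler => u v; apply: eq_sweedler => u' v'.
  by rewrite antipodeM mulr1 mulrA.
rewrite sweedler_coassoc; [|by multilinear..].
under [RHS]eq_sweedler => x y.
  rewrite sweedler_exchange.
  under eq_sweedler => u' v'.
    rewrite (sweedler_antipodel _ (g := fun t => (x * u') ⊗ (S v' * t)));
      last by multilinear.
    rewrite mulr1.
    over.
  rewrite -(linear_sweedler _ _ (g := fun t => eps y *: t));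
    last by multilinear.
  over.
by rewrite sweedler_counitr //; multilinear.
Qed.

(** The identity P P1 ⊗ S(P2) = P ⊗ P is carried to Delta(P)(1 ⊗ P) = P ⊗ P by
    x ⊗ y |-> y ⊗ S(x), since Delta(P) = Delta(S(P)) = S(P2) ⊗ S(P1). *)
Lemma right_group_like_of_comul_mul P :
    is_projection P -> P <> 0 ->
    Delta P * (1 ⊗ P) = Delta P * (P ⊗ 1) ->
  S P = P /\ right_group_like H P.
Proof.
move=> PP P0 eqP.
(* The counit on the first leg compares P P with eps(P1 P) P2 = eps(P) P. *)
have eP : eps P = 1.
  apply: counit_eq1 => //.
  have bf := counitl_bilinear eps.
  have := congr1 (tlift (fun x y => eps x *: y)) eqP.
  rewrite !tlift_comul_mulr //.
  under eq_sweedler => x y do rewrite mulr1.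
  rewrite (sweedler_counitl _ (g := fun y => y * P)); last by multilinear.
  under [X in _ = X -> _]eq_sweedler => x y.
    rewrite mulr1 (counit_monoid_morphism H).2 -scalerA.
    over.
  by rewrite (sweedler_counitl _ (g := fun y => eps P *: y)) ?PP //; multilinear.
have SP : S P = P.
  have bf := antipodel_bilinear S.
  have := congr1 (tlift (fun x y => S x * y)) eqP.
  rewrite !tlift_comul_mulr //.
  under eq_sweedler => x y do rewrite mulr1 mulrA.
  rewrite (sweedler_antipodel _ (g := fun t => t * P)); last by multilinear.
  under eq_sweedler => x y do rewrite mulr1 antipodeM -mulrA.
  rewrite (sweedler_antipodel _ (g := fun t => S P * t)); last by multilinear.
  by rewrite eP !scale1r mul1r mulr1.
have rP : Delta P * (1 ⊗ P) = P ⊗ P.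
  have lswap : linear (tlift (fun u v : A => v ⊗ S u)).
    by apply: tlift_linear; bilinear.
  have := congr1 (tlift (fun u v => v ⊗ S u)) (mul_comul_antipode_tens eqP).
  rewrite linear_sweedler // tlift_tens; last by bilinear.
  rewrite SP => <-; rewrite -{1}SP comul_antipode.
  rewrite (linear_sweedler _ _ (g := fun t : (A ⊗ A)%type => t * (1 ⊗ P))); last by multilinear.
  apply: eq_sweedler => x y; rewrite tensM tlift_tens; last by bilinear.
  by rewrite mulr1 antipodeM SP.
split=> //; split=> //.
have := congr1 tens_antipode_flip rP; rewrite eqP tens_antipode_flipM.
by rewrite tens_antipode_flip_comul !tens_antipode_flip_tens antipode1 SP.
Qed.

End Sweedler.

Theorem theorem3p5 (k : fieldType) (A : algType k) (H : hopfAlgebra A)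
    (S_invertible : bijective (antipode H))
    (P : A) (P_neq0 : P <> 0) (P_proj : is_projection P) :
  let S := antipode H in
  let Delta := comul H in
  [<-> (*1*) right_group_like H P /\ S P = P;
       (*2*) right_group_like H P /\ S (S P) = P;
       (*3*) right_group_like H P /\ P * S P = S P * P;
       (*4*) left_group_like H P /\ S P = P;
       (*5*) left_group_like H P /\ S (S P) = P;
       (*6*) left_group_like H P /\ P * S P = S P * P;
       (*7*) two_sided_group_like H P;
       (*8*) Delta P * (1 ⊗ P) = Delta P * (P ⊗ 1)].
Proof.
move=> S Delta; tfae.
- by case=> rP SP; rewrite /S in SP *; split; rewrite ?SP.
- case=> rP SSP; split=> //; have [SPP _] := right_group_like_antipode rP.
  suff SP : S P = P by rewrite SP.
  by rewrite -{1}SPP /S antipodeM -/S SSP.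
- case=> rP PS; have [SPP PSP] := right_group_like_antipode rP.
  have SP : S P = P by rewrite -[LHS]PSP [LHS]PS.
  by split=> //; apply: right_group_like_left.
- by case=> lP SP; rewrite /S in SP *; split; rewrite ?SP.
- case=> lP SSP; split=> //; have [_ PSP] := left_group_like_antipode lP.
  suff SP : S P = P by rewrite SP.
  by rewrite -{1}PSP /S antipodeM -/S SSP.
- case=> lP PS; have [SPP PSP] := left_group_like_antipode lP.
  have SP : S P = P by rewrite -[LHS]SPP -[LHS]PS.
  by split=> //; apply: left_group_like_right.
- by case=> [[_ _ lP _] [_ _ rP _]]; rewrite [LHS]rP [RHS]lP.
- move=> eqP.
  by have [] := right_group_like_of_comul_mul P_proj P_neq0 eqP.
Qed.
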